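(* Let $n\ge t\ge 2$ be integers, let $k$ be a field, let $R=k[x_1,\ldots,x_n]$, and let $L_n$ be the line graph on $\{x_1,\ldots,x_n\}$. Then $$\operatorname{pd}(R/I_t(L_n))=\begin{cases}\dfrac{2(n-d)}{t+1} & \text{if } n\equiv d \pmod{t+1}\text{ with }0\le d\le t-1,\\[2mm] \dfrac{2n-(t-1)}{t+1} & \text{if } n\equiv t\pmod{t+1}.\end{cases}$$
   Context: The line graph $L_n$ is the directed tree with vertex set $\{x_1,\ldots,x_n\}$ and directed edges $(x_j,x_{j+1})$ for $j=1,\ldots,n-1$. The vertices are identified with the variables of $R$. A path of length $t$ in a directed graph is a sequence of $t$ vertices $x_{i_1},\ldots,x_{i_t}$ with $(x_{i_j},x_{i_{j+1}})$ a directed edge for $j=1,\ldots,t-1$ (length counts vertices). The path ideal $I_t(L_n)\subseteq R$ is generated by the monomials $x_{i_1}\cdots x_{i_t}$ over all paths of length $t$; thus $I_t(L_n)=(x_ix_{i+1}\cdots x_{i+t-1} : 1\le i\le n-t+1)$. $\operatorname{pd}(M)$ denotes the projective dimension of the graded $R$-module $M$, i.e. the length of its minimal graded free resolution. *)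

(* Defs.v *)
From HB Require Import structures.
From mathcomp Require Import all_boot all_order all_algebra.
From mathcomp Require Import boolp.
From mathcomp Require Import mpoly.

Set Implicit Arguments.
Unset Strict Implicit.
Unset Printing Implicit Defensive.

Import GRing.Theory Quotient.
Local Open Scope ring_scope.
Local Open Scope quotient_scope.

Section IdealGen.
Context {R : comNzRingType}.
Implicit Types s : seq R.

Definition ideal_gen s : {pred R} :=
  fun p => `[< exists c : 'I_(size s) -> R, p = \sum_(i < size s) c i * s`_i >].

Lemma ideal_genP s p :
  reflect (exists c : 'I_(size s) -> R, p = \sum_(i < size s) c i * s`_i)
          (p \in ideal_gen s).
Proof. exact: asboolP. Qed.

Lemma ideal_genMl s a p : p \in ideal_gen s -> a * p \in ideal_gen s.
Proof.
move=> /ideal_genP[c ->]; apply/ideal_genP; exists (fun i => a * c i).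
by rewrite mulr_sumr; apply: eq_bigr => i _; rewrite mulrA.
Qed.

Lemma ideal_gen_zmod_closed s : zmod_closed (ideal_gen s).
Proof.
split.
  apply/ideal_genP; exists (fun=> 0).
  by rewrite big1 // => i _; rewrite mul0r.
move=> _ _ /ideal_genP[c ->] /ideal_genP[d ->]; apply/ideal_genP.
exists (fun i => c i - d i); rewrite -sumrB.
by apply: eq_bigr => i _; rewrite mulrBl.
Qed.

HB.instance Definition _ s :=
  GRing.isZmodClosed.Build R (ideal_gen s) (ideal_gen_zmod_closed s).

End IdealGen.

Section QuotientModule.
Context {R : comNzRingType}.
Variable s : seq R.

Definition quot_mod : Type := {quot (ideal_gen s)}.
HB.instance Definition _ := GRing.Zmodule.on quot_mod.

Definition quot_pi (p : R) : quot_mod := \pi_({quot (ideal_gen s)}) p.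

Definition quot_scale (a : R) (x : quot_mod) : quot_mod :=
  quot_pi (a * repr (x : {quot (ideal_gen s)})).

Lemma quot_piE p q : (quot_pi p == quot_pi q) = (p - q \in ideal_gen s).
Proof. by rewrite idealrBE. Qed.

Lemma quot_piB : zmod_morphism quot_pi.
Proof. exact: (raddfB \pi_({quot (ideal_gen s)})). Qed.

HB.instance Definition _ := GRing.isZmodMorphism.Build R quot_mod quot_pi quot_piB.

Lemma quot_pi_surj x : exists p, x = quot_pi p.
Proof. by exists (repr (x : {quot (ideal_gen s)})); rewrite /quot_pi reprK. Qed.

Lemma quot_scaleE a p : quot_scale a (quot_pi p) = quot_pi (a * p).
Proof.
apply/eqP; rewrite quot_piE -mulrBr ideal_genMl // -quot_piE.
by rewrite /quot_pi reprK.
Qed.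

Lemma quot_scaleA a b x : quot_scale a (quot_scale b x) = quot_scale (a * b) x.
Proof. by have [p ->] := quot_pi_surj x; rewrite !quot_scaleE mulrA. Qed.

Lemma quot_scale1 : left_id 1 quot_scale.
Proof. by move=> x; have [p ->] := quot_pi_surj x; rewrite quot_scaleE mul1r. Qed.

Lemma quot_scaleDr : right_distributive quot_scale +%R.
Proof.
move=> a x y; have [p ->] := quot_pi_surj x; have [q ->] := quot_pi_surj y.
by rewrite -raddfD !quot_scaleE mulrDr raddfD.
Qed.

Lemma quot_scaleDl x : {morph quot_scale^~ x : a b / a + b}.
Proof.
move=> a b; have [p ->] := quot_pi_surj x.
by rewrite !quot_scaleE mulrDl raddfD.
Qed.

HB.instance Definition _ := GRing.Zmodule_isLmodule.Build R quot_mod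
  quot_scaleA quot_scale1 quot_scaleDr quot_scaleDl.

End QuotientModule.

Section Graded.
Variables (k : fieldType) (n : nat).
Local Notation R := {mpoly k[n]}.

(* Degrees are integers, so that maps between shifted free modules can be
   described uniformly: [R_d = 0] for [d < 0]. *)
Definition homogZ (d : int) (p : R) : Prop :=
  match d with Posz e => p \is e.-homog | Negz _ => p = 0 end.

Record gradedModule := GradedModule {
  gcarrier :> lmodType R;
  gpart : int -> gcarrier -> Prop;
  gpart0 : forall d, gpart d 0;
  gpartB : forall d x y, gpart d x -> gpart d y -> gpart d (x - y);
  gpartZ : forall e d p x, homogZ e p -> gpart d x -> gpart (e + d) (p *: x);
  gpart_span : forall x : gcarrier, exists (s : seq int) (f : int -> gcarrier),
    (forall d, gpart d (f d)) /\ x = \sum_(d <- s) f d;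
  gpart_direct : forall (s : seq int) (f : int -> gcarrier), uniq s ->
    (forall d, gpart d (f d)) -> \sum_(d <- s) f d = 0 ->
    forall d, d \in s -> f d = 0
}.

(* [F_i] is the free module [\bigoplus_j R(- fshift i j)] of rank [frank i],
   realised as row vectors; [F_{i+1} -> F_i] is right multiplication by
   [fdiff i], and [faug : F_0 -> M] is the augmentation. *)
Record gradedFreeRes (M : gradedModule) := GradedFreeRes {
  frank : nat -> nat;
  fshift : forall i, 'I_(frank i) -> int;
  fdiff : forall i, 'M[R]_(frank i.+1, frank i);
  faug : {linear 'rV[R]_(frank 0) -> M};
  fdiff_homog : forall i a b,
    homogZ (fshift a - fshift b) (fdiff i a b);
  faug_homog : forall b, gpart (fshift b) (faug (delta_mx 0 b));
  faug_surj : forall x, exists u, faug u = x;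
  faug_exact : forall u, faug u = 0 <-> exists v, u = v *m fdiff 0;
  fdiff_exact : forall i (u : 'rV[R]_(frank i.+1)),
    u *m fdiff i = 0 <-> exists v, u = v *m fdiff i.+1
}.

(* The image of each differential lies in [m F_i], [m = (x_1, .., x_n)]. *)
Definition minimal_res (M : gradedModule) (F : gradedFreeRes M) : Prop :=
  forall i a b, fdiff F i a b \in ideal_gen [seq ('X_j : R) | j : 'I_n].

Definition res_length (M : gradedModule) (F : gradedFreeRes M) (p : nat) : Prop :=
  (0 < frank F p)%N /\ forall i, (p < i)%N -> frank F i = 0%N.

(* [pd M = p]: a minimal graded free resolution exists, and the common length
   of all of them is [p]. *)
Definition projdim (M : gradedModule) (p : nat) : Prop :=
  (exists F : gradedFreeRes M, minimal_res F) /\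
  (forall F : gradedFreeRes M, minimal_res F -> res_length F p).

Definition pihomogZ (d : int) (p : R) : R :=
  match d with Posz e => pihomog mdeg e p | Negz _ => 0 end.

Lemma pihomogZ_homog d p : homogZ d (pihomogZ d p).
Proof. by case: d => [e|e] //=; exact: pihomogP. Qed.

Lemma pihomogZ_sum d (I : Type) (r : seq I) (F : I -> R) :
  pihomogZ d (\sum_(i <- r) F i) = \sum_(i <- r) pihomogZ d (F i).
Proof.
case: d => e /=; first exact: raddf_sum.
by rewrite big1.
Qed.

Lemma homogZ_pi d e p : homogZ e p -> pihomogZ d p = if d == e then p else 0.
Proof.
case: d e => [d|d] [e|e] //=.
- rewrite eqz_nat; case: eqP => [->|/eqP ne]; first exact: pihomog_dE.
  by rewrite eq_sym in ne; apply: pihomog_ne0.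
- by move=> ->; rewrite raddf0.
- by move=> ->; case: ifP.
Qed.

Lemma homogZM d e p q : homogZ d p -> homogZ e q -> homogZ (d + e) (p * q).
Proof.
have h0 c : homogZ c (0 : R) by case: c => //= c; exact: dhomog0.
case: d e => [d|d] [e|e]; rewrite [homogZ _ p]/= [homogZ _ q]/=.
- by move=> hp hq; apply: (dhomogM hp hq).
- by move=> _ ->; rewrite mulr0; apply: h0.
- by move=> -> _; rewrite mul0r; apply: h0.
- by move=> _ ->; rewrite mulr0; apply: h0.
Qed.

Section Quotient.
Variable s : seq R.
Hypothesis hs : all (fun p => p \is homog mdeg) s.

Lemma ideal_gen_pihomog d p :
  p \in ideal_gen s -> pihomogZ d p \in ideal_gen s.
Proof.
move=> /ideal_genP[c ->]; rewrite pihomogZ_sum; apply: rpred_sum => i _.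
have /homogP[e he] := allP hs _ (mem_nth 0 (ltn_ord i)).
have cE := pihomog_partitionE (leqnn (mmeasure mdeg (c i))).
rewrite cE mulr_suml pihomogZ_sum; apply: rpred_sum => j _.
have hj : homogZ (j + e)%N (pihomog mdeg j (c i) * s`_i).
  by apply: dhomogM => //; exact: pihomogP.
rewrite (homogZ_pi _ hj); case: ifP => _; last exact: rpred0.
apply: ideal_genMl; apply/ideal_genP; exists (fun l => (l == i)%:R).
rewrite (bigD1 i) //= eqxx mul1r big1 ?addr0 // => l /negbTE ->.
by rewrite mul0r.
Qed.

Definition quot_part (d : int) (x : quot_mod s) : Prop :=
  exists2 p, homogZ d p & x = quot_pi s p.

Lemma quot_part0 d : quot_part d 0.
Proof. by exists 0; [case: d => //= d; exact: dhomog0 | rewrite raddf0]. Qed.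

Lemma quot_partB d x y : quot_part d x -> quot_part d y -> quot_part d (x - y).
Proof.
move=> [p hp ->] [q hq ->]; exists (p - q); last by rewrite raddfB.
by case: d hp hq => /= d; [exact: rpredB | move=> -> ->; rewrite subr0].
Qed.

Lemma quot_partZ e d p (x : quot_mod s) :
  homogZ e p -> quot_part d x -> quot_part (e + d) (p *: x).
Proof.
move=> hp [q hq ->]; exists (p * q); first exact: homogZM.
exact: quot_scaleE.
Qed.

Lemma quot_part_span (x : quot_mod s) :
  exists (r : seq int) (f : int -> quot_mod s),
    (forall d, quot_part d (f d)) /\ x = \sum_(d <- r) f d.
Proof.
have [p ->] := quot_pi_surj x.
exists [seq Posz i | i <- iota 0 (mmeasure mdeg p)].
exists (fun d => quot_pi s (pihomogZ d p)); split.
  by move=> d; exists (pihomogZ d p) => //; exact: pihomogZ_homog.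
rewrite big_map -raddf_sum; congr quot_pi.
rewrite {1}(pihomog_partitionE (leqnn (mmeasure mdeg p))).
by rewrite -(big_mkord xpredT (fun i => pihomog mdeg i p)) /index_iota subn0.
Qed.

Lemma quot_part_direct (r : seq int) (f : int -> quot_mod s) : uniq r ->
  (forall d, quot_part d (f d)) -> \sum_(d <- r) f d = 0 ->
  forall d, d \in r -> f d = 0.
Proof.
move=> ur hf sum0 d dr.
have [g hg] : {g : int -> R & forall d, homogZ d (g d) /\ f d = quot_pi s (g d)}.
  apply: (boolp.choice (P := fun e p => homogZ e p /\ f e = quot_pi s p)) => e.
  by have [p] := hf e; exists p.
have /eqP : quot_pi s (\sum_(d <- r) g d) = 0.
  by rewrite raddf_sum -[RHS]sum0; apply: eq_bigr => e _; rewrite (hg e).2.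
rewrite -(raddf0 (quot_pi s)) quot_piE subr0 => /(ideal_gen_pihomog d).
rewrite pihomogZ_sum (bigD1_seq d) //= (homogZ_pi _ (hg d).1) eqxx.
rewrite big1 ?addr0 => [gI|e ne]; last first.
  by rewrite (homogZ_pi _ (hg e).1) eq_sym (negbTE ne).
by rewrite (hg d).2; apply/eqP; rewrite quot_piE subr0.
Qed.

Definition quot_graded : gradedModule :=
  GradedModule quot_part0 quot_partB quot_partZ quot_part_span quot_part_direct.

End Quotient.

(* Generators of the path ideal [I_t(G)] of the directed graph [G] on the
   variables with edge relation [e]; the length [t] of a path counts its
   vertices. *)
Definition path_gens (t : nat) (e : rel 'I_n) : seq R :=
  [seq \prod_(i <- p) 'X_i | p : t.-tuple 'I_n <- enum {: t.-tuple 'I_n} & sorted e p].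

Lemma path_gens_homog t e : all (fun p => p \is homog mdeg) (path_gens t e).
Proof.
apply/allP => _ /mapP[p _ ->].
elim: (val p) => [|i r IH]; first by rewrite big_nil; apply/homogP; exists 0%N; exact: dhomog1.
rewrite big_cons; move/homogP: IH => [d hd].
by apply/homogP; exists (1 + d)%N; apply: dhomogM => //; rewrite dhomogX; apply/eqP/mdeg1.
Qed.

Definition path_quot (t : nat) (e : rel 'I_n) : gradedModule :=
  quot_graded (path_gens_homog t e).

End Graded.

(* Vertex [i : 'I_n] is [x_{i+1}]. *)
Definition line_graph (n : nat) : rel 'I_n := fun i j => j == i.+1 :> nat.
Arguments line_graph : clear implicits.

(* Main.v *)
From HB Require Import structures.
Require Import Defs.
From mathcomp Require Import all_boot all_order all_algebra.
From mathcomp Require Import boolp.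
From mathcomp Require Import mpoly.
From mathcomp Require Import zify.

Set Implicit Arguments.
Unset Strict Implicit.
Unset Printing Implicit Defensive.

Import GRing.Theory.
Local Open Scope ring_scope.

(** Let w_i = x_i ... x_(i+t-1) and I_c = (w_0, .., w_(c-1)). The colon ideal
    I_c : w_c is J = (x_(c-1)) + I_(c-t), so a resolution of R/I_(c+1) is the
    mapping cone of multiplication by w_c from a resolution of R/J to one of
    R/I_c, and R/J is itself resolved by a cone over R/I_(c-t). Writing
    w_c = x_(c+t-1) g', one already has g' J contained in I_c, so the comparison
    map can be taken divisible by x_(c+t-1) and the cone is minimal.
    Hence pd(R/I_(c+1)) = max(pd(R/I_c), pd(R/I_(c-t)) + 2), which gives the
    formula. All minimal resolutions have the same ranks, because a comparison
    map between them is a homotopy equivalence and becomes invertible at the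
    origin. *)

(** * Lifting matrices through a differential *)

Section MatrixRows.
Context {R : comNzRingType}.

(** Exactness is stated for single row vectors; choosing a lift of each row turns it into the
    lifting property of a free module. *)
Lemma mulmx_factor m p q (A : 'M[R]_(m, q)) (D : 'M_(p, q)) :
  (forall u : 'rV_m, exists v, u *m A = v *m D) -> exists B, A = B *m D.
Proof.
move=> h.
have /boolp.choice[v hv] : forall a, exists v, row a A = v *m D.
  by move=> a; have [v] := h (delta_mx 0 a); exists v; rewrite rowE.
exists (\matrix_a v a); apply/row_matrixP => a.
by rewrite row_mul rowK hv.
Qed.

End MatrixRows.

(** * Independence of the ranks from the minimal resolution *)

Section Uniqueness.
Variables (k : fieldType) (n : nat) (M : gradedModule k n).
Local Notation R := {mpoly k[n]}.

Let fdiffK (F : gradedFreeRes M) i : fdiff F i.+1 *m fdiff F i = 0.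
Proof.
apply/row_matrixP => a; rewrite row0 row_mul rowE.
by apply/fdiff_exact; exists (delta_mx 0 a).
Qed.

Let fdiff_lift (F : gradedFreeRes M) i m (A : 'M_(m, frank F i.+1)) :
  A *m fdiff F i = 0 -> exists B, A = B *m fdiff F i.+1.
Proof.
move=> h; apply: mulmx_factor => u; apply/fdiff_exact.
by rewrite -mulmxA h mulmx0.
Qed.

Let faug_lift (F : gradedFreeRes M) m (A : 'M_(m, frank F 0)) :
  (forall u, faug F (u *m A) = 0) -> exists B, A = B *m fdiff F 0.
Proof. by move=> h; apply: mulmx_factor => u; apply/faug_exact. Qed.

Let faug_diff (F : gradedFreeRes M) u : faug F (u *m fdiff F 0) = 0.
Proof. by apply/faug_exact; exists u. Qed.

Let faug_comparison (F G : gradedFreeRes M) :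
  exists f : 'M_(frank F 0, frank G 0), forall u, faug G (u *m f) = faug F u.
Proof.
have /boolp.choice[v hv] : forall a, exists v, faug G v = faug F (delta_mx 0 a).
  by move=> a; apply: faug_surj.
exists (\matrix_a v a) => u; rewrite mulmx_sum_row [in RHS](row_sum_delta u).
rewrite !linear_sum; apply: eq_bigr => a _.
by rewrite !linearZ /= rowK hv.
Qed.

Lemma ideal_gen_vars_eval0 (p : R) :
  p \in ideal_gen [seq ('X_j : R) | j : 'I_n] -> p.@[fun=> 0] = 0.
Proof.
move=> /ideal_genP[c ->]; rewrite rmorph_sum big1 // => i _ /=.
rewrite rmorphM /=; have /mapP[j _ ->] := mem_nth 0 (ltn_ord i).
by rewrite mevalXU mulr0.
Qed.

Let eval0 p q (A : 'M[R]_(p, q)) : 'M[k]_(p, q) := map_mx (meval (fun=> 0)) A.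

Let minimal_eval0 (F : gradedFreeRes M) : minimal_res F -> forall i, eval0 (fdiff F i) = 0.
Proof.
move=> mF i; apply/matrixP => a b; rewrite !mxE.
exact: ideal_gen_vars_eval0.
Qed.

Let rank_leq_retract p q (A : 'M[k]_(p, q)) (B : 'M_(q, p)) :
  A *m B = 1%:M -> (p <= q)%N.
Proof.
move=> h; have := mxrankM_maxl A B; rewrite h mxrank1 => /leq_trans; apply.
exact: rank_leq_col.
Qed.

(** The induction carries only one degree of the comparison maps [f], [g] and of the homotopy [h].
    The last clause is the homotopy identity composed with the differential: the term coming from
    the previous homotopy vanishes there, so degree 0 needs no special form. *)
Let homotopic (F G : gradedFreeRes M) i :
  minimal_res F -> (frank F i <= frank G i)%N /\
  exists f g h f' g',
  [/\ f' *m fdiff G i = fdiff F i *m f, g' *m fdiff F i = fdiff G i *m g &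
      fdiff F i *m (f *m g - 1%:M - h *m fdiff F i) = 0].
Proof.
move=> mF; have dF0 := minimal_eval0 mF; elim: i => [|i [_ [f [g [h [f' [g' [Ef Eg Eh]]]]]]]].
  have [f hf] := faug_comparison F G; have [g hg] := faug_comparison G F.
  have [h Eh] : exists h, f *m g - 1%:M = h *m fdiff F 0.
    apply: faug_lift => u; rewrite mulmxBr mulmx1 mulmxA linearB /= hg hf.
    exact: subrr.
  split.
    (* At the origin a minimal differential vanishes, so [f *m g] becomes the identity over [k]. *)
    apply: (@rank_leq_retract _ _ (eval0 f) (eval0 g)).
    have := congr1 (@eval0 _ _) Eh.
    rewrite /eval0 map_mxB map_mx1 !map_mxM /= -[map_mx _ (fdiff _ _)]/(eval0 _) dF0 mulmx0.
    exact: subr0_eq.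
  have [f' Ef] : exists f', fdiff F 0 *m f = f' *m fdiff G 0.
    by apply: faug_lift => u; rewrite mulmxA hf faug_diff.
  have [g' Eg] : exists g', fdiff G 0 *m g = g' *m fdiff F 0.
    by apply: faug_lift => u; rewrite mulmxA hg faug_diff.
  by exists f, g, h, f', g'; split=> //; rewrite Eh subrr mulmx0.
(* By the last clause of the induction hypothesis the left side is a cycle, hence lifts; the lift is
   the next homotopy. *)
have [h' Eh'] : exists h', f' *m g' - 1%:M - fdiff F i *m h = h' *m fdiff F i.+1.
  apply: fdiff_lift; rewrite -Eh !mulmxBl !mulmxBr mul1mx mulmx1.
  by rewrite -mulmxA Eg !mulmxA Ef.
split.
  apply: (@rank_leq_retract _ _ (eval0 f') (eval0 g')).
  have := congr1 (@eval0 _ _) Eh'.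
  rewrite /eval0 !map_mxB map_mx1 !map_mxM /= -!/(eval0 (fdiff _ _)) !dF0 mulmx0 mul0mx subr0.
  exact: subr0_eq.
have [f'' Ef''] : exists f'', fdiff F i.+1 *m f' = f'' *m fdiff G i.+1.
  by apply: fdiff_lift; rewrite -mulmxA Ef mulmxA fdiffK mul0mx.
have [g'' Eg''] : exists g'', fdiff G i.+1 *m g' = g'' *m fdiff F i.+1.
  by apply: fdiff_lift; rewrite -mulmxA Eg mulmxA fdiffK mul0mx.
exists f', g', h', f'', g''; split=> //.
by rewrite -Eh' opprB addrC subrK mulmxA fdiffK mul0mx.
Qed.

Lemma minimal_res_rank (F G : gradedFreeRes M) i :
  minimal_res F -> minimal_res G -> frank F i = frank G i.
Proof.
move=> mF mG; apply/eqP; rewrite eqn_leq.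
by rewrite (homotopic G i mF).1 (homotopic F i mG).1.
Qed.

Lemma projdim_minimal_res (F : gradedFreeRes M) p :
  minimal_res F -> res_length F p -> projdim M p.
Proof.
move=> mF [Fp Fgt]; split; first by exists F.
move=> G mG; split; first by rewrite (minimal_res_rank p mG mF).
by move=> i pi; rewrite (minimal_res_rank i mG mF) Fgt.
Qed.

End Uniqueness.

(** Serves to choose comparison maps degree by degree, where the matrix size, hence the type, varies
    with the degree. *)
Lemma dependent_choice (T : nat -> Type) (Q : forall i, T i -> T i.+1 -> Prop) (x0 : T 0%N) :
  (forall i (x : T i), exists y, Q i x y) ->
  exists2 f : forall i, T i, f 0%N = x0 & forall i, Q i (f i) (f i.+1).
Proof.
move=> h; pose next i x := projT1 (cid (h i x)).
exists (fun i => nat_rect T x0 next i) => // i.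
exact: projT2 (cid (h i _)).
Qed.

(** * Homogeneous matrices and homogeneous lifts *)

Section HomogeneousMatrices.
Variables (k : fieldType) (n : nat).
Local Notation R := {mpoly k[n]}.

Lemma homogZ0 d : homogZ d (0 : R).
Proof. by case: d => d //=; exact: dhomog0. Qed.

Lemma homogZN d (p : R) : homogZ d p -> homogZ d (- p).
Proof. by case: d => d /=; [move=> h; rewrite rpredN | move=> ->; rewrite oppr0]. Qed.

Lemma homogZ_sum d (I : Type) (r : seq I) (F : I -> R) :
  (forall i, homogZ d (F i)) -> homogZ d (\sum_(i <- r) F i).
Proof.
case: d => d /= h; first by apply: rpred_sum => i _; exact: h.
by rewrite big1.
Qed.

Lemma pihomogZ_mulr d e (p q : R) :
  homogZ e q -> pihomogZ (d + e) (p * q) = pihomogZ d p * q.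
Proof.
move=> hq; have pE := pihomog_partitionE (leqnn (mmeasure mdeg p)).
rewrite [in LHS]pE [in RHS]pE mulr_suml !pihomogZ_sum mulr_suml.
apply: eq_bigr => j _.
have hj : homogZ (Posz j) (pihomog mdeg j p) by exact: pihomogP.
rewrite (homogZ_pi _ (homogZM hj hq)) (homogZ_pi _ hj).
by rewrite (inj_eq (addIr e)); case: ifP; rewrite ?mul0r.
Qed.

Definition mx_homog m p (s : 'I_m -> int) (s' : 'I_p -> int) (A : 'M[R]_(m, p)) :=
  forall a b, homogZ (s a - s' b) (A a b).

Lemma mx_homogM m p q s s' s'' (A : 'M_(m, p)) (B : 'M_(p, q)) :
  mx_homog s s' A -> mx_homog s' s'' B -> mx_homog s s'' (A *m B).
Proof.
move=> hA hB a b; rewrite mxE; apply: homogZ_sum => c.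
have -> : s a - s'' b = (s a - s' c) + (s' c - s'' b) by rewrite addrA subrK.
exact: homogZM.
Qed.

Lemma mx_homogZ m p s s' (A : 'M_(m, p)) d q :
  homogZ d q -> mx_homog s s' A -> mx_homog (fun a => s a + d) s' (q *: A).
Proof.
by move=> hq hA a b; rewrite mxE addrAC addrC; apply: homogZM.
Qed.

Lemma mx_homog_shift m p s s' (A : 'M_(m, p)) d :
  mx_homog s s' A -> mx_homog (fun a => s a + d) (fun a => s' a + d) A.
Proof. by move=> hA a b /=; rewrite opprD addrACA subrr addr0. Qed.

(** Each entry of [B] is replaced by its component of the required degree; taking components
    commutes with multiplication by the homogeneous entries of [D], so the product is unchanged. *)
Lemma mx_homog_factor m p q s s' s'' (A : 'M_(m, q)) (B : 'M_(m, p)) (D : 'M_(p, q)) :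
  mx_homog s s'' A -> mx_homog s' s'' D -> A = B *m D ->
  exists2 C, mx_homog s s' C & A = C *m D.
Proof.
move=> hA hD AE; exists (\matrix_(a, b) pihomogZ (s a - s' b) (B a b)).
  by move=> a b; rewrite mxE; exact: pihomogZ_homog.
apply/matrixP => a c; rewrite [RHS]mxE.
rewrite -[LHS](_ : pihomogZ (s a - s'' c) (A a c) = _); last first.
  by rewrite (homogZ_pi _ (hA a c)) eqxx.
rewrite {1}AE mxE pihomogZ_sum; apply: eq_bigr => b _.
by rewrite mxE -(pihomogZ_mulr _ _ (hD b c)) addrA subrK.
Qed.

End HomogeneousMatrices.

(** * Minimal resolutions of R/I and mapping cones *)

Section IdealResolutions.
Variables (k : fieldType) (n : nat).
Local Notation R := {mpoly k[n]}.
Local Notation max_ideal := (ideal_gen [seq ('X_j : R) | j : 'I_n]).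

Implicit Types I J K : R -> Prop.

(* A minimal graded free resolution of [R/I] in matrix form. The augmentation
   is right multiplication by the column [raug] followed by [R -> R/I], and
   [rone] is a homogeneous lift of [1]. *)
Record idealRes I := IdealRes {
  rrank : nat -> nat;
  rdeg : forall i, 'I_(rrank i) -> int;
  rdiff : forall i, 'M[R]_(rrank i.+1, rrank i);
  raug : 'cV[R]_(rrank 0);
  rone : 'rV[R]_(rrank 0);
  rdiff_homog : forall i, mx_homog (@rdeg i.+1) (@rdeg i) (rdiff i);
  raug_homog : mx_homog (@rdeg 0) (fun=> 0) raug;
  rone_homog : mx_homog (fun=> 0) (@rdeg 0) rone;
  rone_aug : rone *m raug = 1%:M;
  rdiff_min : forall i a b, rdiff i a b \in max_ideal;
  raug_exact : forall u : 'rV_(rrank 0),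
    I ((u *m raug) 0 0) <-> exists v, u = v *m rdiff 0;
  rdiff_exact : forall i (u : 'rV_(rrank i.+1)),
    u *m rdiff i = 0 <-> exists v, u = v *m rdiff i.+1
}.

Arguments rdiff_homog {I} _ _ _ _.
Arguments raug_homog {I} _ _ _.
Arguments rone_homog {I} _ _ _.

Lemma rdiffK I (F : idealRes I) i : rdiff F i.+1 *m rdiff F i = 0.
Proof.
apply/row_matrixP => a; rewrite row0 row_mul rowE.
by apply/rdiff_exact; exists (delta_mx 0 a).
Qed.

Lemma idealResP I (F : idealRes I) p :
  I p <-> exists v, p *: rone F = v *m rdiff F 0.
Proof.
by rewrite -raug_exact -scalemxAl rone_aug !mxE eqxx mulr1.
Qed.

(** [I] is a bare predicate; its closure under multiplication is read off from the resolution, since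
    [I p] says that [p *: rone F] is a boundary. *)
Lemma idealRes_memM I (F : idealRes I) a p : I p -> I (a * p).
Proof.
move=> /(idealResP F)[v hv]; apply/(idealResP F).
by exists (a *: v); rewrite -scalerA hv scalemxAl.
Qed.

Definition cone_rank (r s : nat -> nat) (i : nat) : nat :=
  if i is j.+1 then (r i + s j)%N else r 0%N.

(* The mapping cone of multiplication by [y * g] from [R/J] to [R/I]. It is
   minimal because [g] already maps [J] into [I], so that the lift can be taken
   to be [y] times a lift of multiplication by [g]. *)
Section Cone.
Variables (I J K : R -> Prop) (y g : R) (d e : int).
Variables (F : idealRes I) (G : idealRes J).
Hypotheses (hy : homogZ d y) (hg : homogZ e g) (ym : y \in max_ideal).
Hypotheses (gJ : forall p, J p -> I (g * p)) (colonJ : forall p, I (y * g * p) -> J p).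
Hypothesis KE : forall p, K p <-> exists r, I (p - r * (y * g)).

Let comparison : exists phi : forall i, 'M[R]_(rrank G i, rrank F i),
  [/\ phi 0%N = g *: (raug G *m rone F),
      forall i, mx_homog (fun a => rdeg a + e) (@rdeg _ F i) (phi i) &
      forall i, phi i.+1 *m rdiff F i = rdiff G i *m phi i].
Proof.
(* The second clause of [P] guarantees that a next map exists, so the choice never gets stuck. *)
pose P i (phi : 'M[R]_(rrank G i, rrank F i)) :=
  mx_homog (fun a => rdeg a + e) (@rdeg _ F i) phi /\
  exists B, rdiff G i *m phi = B *m rdiff F i.
pose T i := {phi | P i phi}.
have [x0 x0E] : exists x0 : T 0%N, sval x0 = g *: (raug G *m rone F).
  have h0 : mx_homog (fun a => rdeg a + e) (@rdeg _ F 0) (g *: (raug G *m rone F)).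
    exact: mx_homogZ hg (mx_homogM (raug_homog G) (rone_homog F)).
  have h1 : exists B, rdiff G 0 *m (g *: (raug G *m rone F)) = B *m rdiff F 0.
    apply: mulmx_factor => u; apply/raug_exact.
    rewrite -scalemxAr -scalemxAr -scalemxAl -!mulmxA rone_aug mulmx1 mxE.
    by apply: gJ; rewrite mulmxA; apply/raug_exact; exists u.
  by exists (exist (P 0%N) _ (conj h0 h1)).
have [|phi phi0 hphi] := @dependent_choice T
    (fun i x x' => sval x' *m rdiff F i = rdiff G i *m sval x) x0.
  move=> i [phi /= [h [B hB]]].
  have hom : mx_homog (fun a => rdeg a + e) (@rdeg _ F i) (rdiff G i *m phi).
    by apply: mx_homogM h; apply: mx_homog_shift; exact: rdiff_homog.
  have [C hC CE] := mx_homog_factor hom (rdiff_homog F i) hB.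
  suff h1 : exists B, rdiff G i.+1 *m C = B *m rdiff F i.+1.
    by exists (exist (P i.+1) C (conj hC h1)).
  apply: mulmx_factor => u; apply/rdiff_exact.
  by rewrite -!mulmxA -CE !mulmxA -(mulmxA u) rdiffK mulmx0 mul0mx.
exists (fun i => sval (phi i)); split=> //; first by rewrite phi0.
by move=> i; case: (proj2_sig (phi i)).
Qed.

Lemma cone_idealRes : exists H : idealRes K, rrank H =1 cone_rank (rrank F) (rrank G).
Proof.
have [phi [phi0 phi_h phiK]] := comparison.
pose psi i := y *: phi i.
have psi_h i : mx_homog (fun a => rdeg a + (e + d)) (@rdeg _ F i) (psi i).
  by move=> a b; rewrite addrA; apply: (mx_homogZ hy (phi_h i)).
have psiK i : psi i.+1 *m rdiff F i = rdiff G i *m psi i.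
  by rewrite -scalemxAl phiK scalemxAr.
have psi0 : psi 0%N *m raug F = (y * g) *: raug G.
  by rewrite /psi phi0 scalerA -scalemxAl -mulmxA rone_aug mulmx1.
have psi_m i a b : psi i a b \in max_ideal.
  by rewrite mxE mulrC ideal_genMl.
pose rr := cone_rank (rrank F) (rrank G).
pose cs i : 'I_(rr i) -> int :=
  match i return 'I_(rr i) -> int with
  | 0 => @rdeg _ F 0
  | j.+1 => fun a => match split a with
                     | inl b => rdeg b | inr b => rdeg b + (e + d) end
  end.
(* The sign on [rdiff G] makes consecutive differentials compose to zero. *)
pose cd i : 'M[R]_(rr i.+1, rr i) :=
  match i return 'M[R]_(rr i.+1, rr i) with
  | 0 => col_mx (rdiff F 0) (psi 0%N)
  | j.+1 => block_mx (rdiff F j.+1) 0 (psi j.+1) (- rdiff G j)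
  end.
have csl i a : cs i.+1 (lshift _ a) = rdeg a by rewrite /cs (unsplitK (inl a)).
have csr i a : cs i.+1 (rshift _ a) = rdeg a + (e + d).
  by rewrite /cs (unsplitK (inr a)).
have cd0 (u : 'rV_(rrank F 1)) (v : 'rV_(rrank G 0)) :
    row_mx u v *m cd 0%N = u *m rdiff F 0 + v *m psi 0%N.
  exact: mul_row_col.
have cdS i (u : 'rV_(rrank F i.+2)) (v : 'rV_(rrank G i.+1)) :
    row_mx u v *m cd i.+1 = row_mx (u *m rdiff F i.+1 + v *m psi i.+1) (- (v *m rdiff G i)).
  by rewrite [LHS]mul_row_block mulmx0 add0r mulmxN.
unshelve eexists (@IdealRes K rr cs cd (raug F) (rone F) _ _ _ _ _ _ _).
- case=> [|i] a b; case: (split_ordP a) => {}a ->; rewrite ?csl ?csr.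
  + by rewrite [cd _ _ _]col_mxEu; exact: rdiff_homog.
  + by rewrite [cd _ _ _]col_mxEd; exact: psi_h.
  + case: (split_ordP b) => {}b ->; rewrite ?csl ?csr.
      by rewrite [cd _ _ _]block_mxEul; exact: rdiff_homog.
    by rewrite [cd _ _ _]block_mxEur mxE; exact: homogZ0.
  case: (split_ordP b) => {}b ->; rewrite ?csl ?csr.
    by rewrite [cd _ _ _]block_mxEdl; exact: psi_h.
  rewrite [cd _ _ _]block_mxEdr mxE opprD addrACA subrr addr0.
  by apply: homogZN; exact: rdiff_homog.
- exact: raug_homog.
- exact: rone_homog.
- exact: rone_aug.
- case=> [|i] a b; case: (split_ordP a) => {}a ->.
  + by rewrite [cd _ _ _]col_mxEu; exact: rdiff_min.
  + by rewrite [cd _ _ _]col_mxEd; exact: psi_m.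
  + case: (split_ordP b) => {}b ->.
      by rewrite [cd _ _ _]block_mxEul; exact: rdiff_min.
    by rewrite [cd _ _ _]block_mxEur mxE rpred0.
  case: (split_ordP b) => {}b ->.
    by rewrite [cd _ _ _]block_mxEdl; exact: psi_m.
  by rewrite [cd _ _ _]block_mxEdr mxE rpredN; exact: rdiff_min.
- move=> u; rewrite KE; split=> [[r hr]|[w ->]].
    (* The image of [v] under [psi 0] has augmentation [r * (y * g)], so subtracting it leaves an
       augmentation in [I]. *)
    pose v := r *: rone G.
    have [w hw] : exists w, u - v *m psi 0%N = w *m rdiff F 0.
      apply/raug_exact; rewrite mulmxBl -mulmxA psi0 -scalemxAr -scalemxAl.
      rewrite rone_aug; move: (u *m raug F) hr => U.
      by rewrite !mxE eqxx mulr1 mulrC.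
    by exists (row_mx w v); rewrite cd0 -hw subrK.
  rewrite -[w](@hsubmxK _ 1 (rrank F 1) (rrank G 0)) cd0 mulmxDl.
  exists ((rsubmx w *m raug G) 0 0).
  rewrite -[_ *m psi _ *m _]mulmxA psi0 -scalemxAr.
  have : I ((lsubmx w *m rdiff F 0 *m raug F) 0 0).
    by apply/raug_exact; exists (lsubmx w).
  move: (_ *m raug F) (_ *m raug G) => A B IA.
  by rewrite !mxE [X in _ - X]mulrC addrK.
- case=> [|i] w; rewrite -[w](@hsubmxK _ 1 (rrank F _) (rrank G _)).
    rewrite cd0; set u := lsubmx w; set v := rsubmx w; split; last first.
      move=> [z]; rewrite -[z](@hsubmxK _ 1 (rrank F 2) (rrank G 1)) cdS.
      move=> /eq_row_mx[-> ->]; rewrite mulmxDl -!mulmxA rdiffK mulmx0 add0r.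
      by rewrite psiK mulNmx mulmxA subrr.
    move=> E.
    (* For a cycle, [y * g] times the augmentation of [v] lies in [I]; the colon hypothesis puts
       that augmentation in [J]. *)
    have [b hb] : exists b, v = b *m rdiff G 0.
      apply/raug_exact; apply: colonJ.
      have -> : y * g * (v *m raug G) 0 0 = -1 * (u *m rdiff F 0 *m raug F) 0 0.
        move/(congr1 (fun A => (A *m raug F) 0 0)): E.
        rewrite mulmxDl -(mulmxA v) psi0 -scalemxAr mul0mx !mxE => /eqP.
        by rewrite addrC addr_eq0 mulN1r => /eqP.
      by apply: (idealRes_memM F); apply/raug_exact; exists u.
    have [a ha] : exists a, u + b *m psi 1%N = a *m rdiff F 1.
      by apply/rdiff_exact; rewrite mulmxDl -mulmxA psiK mulmxA -hb.
    exists (row_mx a (- b)).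
    by rewrite cdS -ha mulNmx addrK hb mulNmx opprK.
  rewrite cdS; set u := lsubmx w; set v := rsubmx w; split; last first.
    move=> [z]; rewrite -[z](@hsubmxK _ 1 (rrank F _) (rrank G _)) cdS.
    move=> /eq_row_mx[-> ->]; rewrite mulmxDl -!mulmxA rdiffK mulmx0 add0r.
    rewrite psiK !mulNmx opprK -[_ *m rdiff G _ *m rdiff G _]mulmxA rdiffK mulmx0 -mulmxA subrr.
    exact: row_mx0.
  rewrite -(@row_mx0 _ 1 (rrank F _) (rrank G _)) => /eq_row_mx[E1 E2].
  have [b hb] : exists b, v = b *m rdiff G i.+1.
    by apply/rdiff_exact; rewrite -[LHS]opprK E2 oppr0.
  have [a ha] : exists a, u + b *m psi i.+2 = a *m rdiff F i.+2.
    by apply/rdiff_exact; rewrite mulmxDl -mulmxA psiK mulmxA -hb.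
  exists (row_mx a (- b)).
  by rewrite cdS -ha mulNmx addrK hb mulNmx opprK.
by [].
Qed.

End Cone.

(** * From the matrix form to graded free resolutions of the quotient module *)

Section ToGradedFreeRes.
Variables (s : seq R) (hs : all (fun p => p \is homog mdeg) s).
Variables (I : R -> Prop) (F : idealRes I).
Hypothesis IE : forall p, I p <-> p \in ideal_gen s.

Let aug (u : 'rV[R]_(rrank F 0)) : quot_graded hs := quot_pi s ((u *m raug F) 0 0).

Let aug_linear : linear aug.
Proof.
move=> a u v; rewrite /aug mulmxDl -scalemxAl mxE raddfD mxE; congr (_ + _).
exact: esym (quot_scaleE _ _ _).
Qed.

HB.instance Definition _ := GRing.isLinear.Build R _ _ _ aug aug_linear.

Lemma quot_minimal_res :
  exists2 H : gradedFreeRes (quot_graded hs), minimal_res H & frank H =1 rrank F.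
Proof.
unshelve eexists (@GradedFreeRes _ _ (quot_graded hs) (rrank F) (@rdeg _ F)
  (rdiff F) aug _ _ _ _ _); last by [].
- exact: rdiff_homog.
- move=> b; exists (raug F b 0); first by rewrite -[rdeg b]subr0; exact: raug_homog.
  by rewrite /= /aug -rowE mxE.
- move=> x; have [p ->] := quot_pi_surj x; exists (p *: rone F).
  by rewrite /= /aug -scalemxAl rone_aug !mxE eqxx mulr1.
- move=> u; rewrite -raug_exact IE /= /aug -[X in _ = X](raddf0 (quot_pi s)).
  by rewrite -[X in _ \in X]/(ideal_gen s) (rwP eqP) quot_piE subr0.
- exact: rdiff_exact.
exact: rdiff_min.
Qed.

End ToGradedFreeRes.
End IdealResolutions.

Lemma mem_ideal_gen (R : comNzRingType) (s : seq R) x : x \in s -> x \in ideal_gen s.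
Proof.
move=> xs; apply/ideal_genP.
have lt : (index x s < size s)%N by rewrite index_mem.
exists (fun i => (i == Ordinal lt)%:R).
rewrite (bigD1 (Ordinal lt)) //= eqxx mul1r nth_index // big1 ?addr0 // => i /negbTE ->.
by rewrite mul0r.
Qed.

(** * Monomial ideals and the cone step on generators *)

Section MonomialIdeals.
Variables (k : fieldType) (n : nat).
Local Notation R := {mpoly k[n]}.
Implicit Types (S T : seq 'X_{1..n}) (m w : 'X_{1..n}) (p q : R).

(** The ideal generated by the monomials in [S], tested on supports, so that colon ideals reduce to
    divisibility of exponents. *)
Definition mono_ideal S p := forall m, m \in msupp p -> exists2 w, w \in S & (w <= m)%MM.

Lemma mono_idealD S p q : mono_ideal S p -> mono_ideal S q -> mono_ideal S (p + q).
Proof.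
by move=> hp hq m /msuppD_le; rewrite mem_cat => /orP[/hp|/hq].
Qed.

Lemma mono_ideal0 S : mono_ideal S 0.
Proof. by move=> m; rewrite msupp0. Qed.

Lemma mono_idealM S q p : mono_ideal S p -> mono_ideal S (q * p).
Proof.
move=> hp m /msuppM_le/allpairsP[[m1 m2] /= [_ /hp[w wS wm] ->]].
by exists w => //; apply: lepm_trans wm _; rewrite addmC lem_addr.
Qed.

Lemma mono_ideal_sum S (I : eqType) (r : seq I) (P : pred I) (F : I -> R) :
  (forall i, i \in r -> P i -> mono_ideal S (F i)) -> mono_ideal S (\sum_(i <- r | P i) F i).
Proof.
move=> h; rewrite big_seq_cond; elim/big_ind: _ => [|p q|i /andP[]]; last exact: h.
  exact: mono_ideal0.
exact: mono_idealD.
Qed.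

Lemma mono_idealX S w m c : w \in S -> (w <= m)%MM -> mono_ideal S (c *: 'X_[m]).
Proof. by move=> wS wm m' /msuppZ_le; rewrite msuppX inE => /eqP->; exists w. Qed.

Lemma mono_ideal_mulX S w p : mono_ideal S ('X_[w] * p) <->
  forall m, m \in msupp p -> exists2 s, s \in S & (s <= w + m)%MM.
Proof.
rewrite mulrC /mono_ideal; split=> h m.
  by move=> mp; apply: h; rewrite (perm_mem (msuppMX _ _)); apply: map_f.
by rewrite (perm_mem (msuppMX _ _)) => /mapP[m' /h ? ->].
Qed.

Lemma mono_ideal_cons S w p :
  mono_ideal (w :: S) p <-> exists r, mono_ideal S (p - r * 'X_[w]).
Proof.
split=> [h|[r h]].
  (* The quotient by ['X_[w]] of the part of [p] divisible by it; every other term is divisible by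
     an element of [S]. *)
  exists (\sum_(m <- msupp p | (w <= m)%MM) p@_m *: 'X_[(m - w)]).
  rewrite mulr_suml (eq_bigr (fun m => p@_m *: 'X_[m])); last first.
    by move=> m wm; rewrite -scalerAl -mpolyXD submK.
  rewrite {1}[p]mpolyE (bigID (fun m => (w <= m)%MM)) /= [X in X - _]addrC addrK.
  apply: mono_ideal_sum => m /h[s]; rewrite inE => /predU1P[-> -> //|sS sm _].
  exact: mono_idealX sS sm.
rewrite -(subrK (r * 'X_[w]) p); apply: mono_idealD.
  by move=> m /h[s sS sm]; exists s; rewrite ?inE ?sS ?orbT.
apply: mono_idealM; rewrite -['X_[w]]scale1r.
by apply: (@mono_idealX _ w); rewrite ?mem_head ?lepm_refl.
Qed.

Lemma mono_ideal_gen S (s : seq R) :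
  (forall w, w \in S -> 'X_[w] \in s) -> (forall q, q \in s -> mono_ideal S q) ->
  forall p, mono_ideal S p <-> p \in ideal_gen s.
Proof.
move=> Ss sS p; split=> [h|/ideal_genP[c ->]]; last first.
  by apply: mono_ideal_sum => i _ _; apply: mono_idealM; apply: sS; exact: mem_nth.
rewrite [p]mpolyE big_seq; apply: rpred_sum => m /h[w wS wm].
rewrite -(submK wm) mpolyXD scalerAl; apply: ideal_genMl.
exact/mem_ideal_gen/Ss.
Qed.

(** Minimality is built into [idealRes], so the length [d] is the projective dimension. *)
Definition has_pd S (d : nat) := exists F : idealRes (mono_ideal S),
  (0 < rrank F d)%N /\ forall i, (d < i)%N -> rrank F i = 0%N.

Lemma has_pd0 : has_pd [::] 0.
Proof.
have I0 p : mono_ideal [::] p <-> p = 0.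
  split=> [h|->]; last exact: mono_ideal0.
  apply/eqP; rewrite -msupp_eq0; case E : (msupp p) => [|m r] //.
  by have [|w] := h m; rewrite ?E ?mem_head ?in_nil.
pose rk (i : nat) := if i is 0 then 1%N else 0%N.
unshelve eexists (@IdealRes _ _ (mono_ideal [::]) rk (fun _ _ => 0)
  (fun i => 0) 1%:M 1%:M _ _ _ _ _ _ _).
- by move=> i [].
- by move=> a b; rewrite subr0 !ord1 mxE; exact: dhomog1.
- by move=> a b; rewrite subr0 !ord1 mxE; exact: dhomog1.
- exact: mulmx1.
- by move=> i [].
- move=> u; rewrite I0 mulmx1; split=> [u0|[v ->]]; last by rewrite mulmx0 mxE.
  by exists 0; rewrite mulmx0; apply/rowP => j; rewrite ord1 mxE.
- by move=> i u; split=> _; [exists 0; rewrite !thinmx0 | rewrite mulmx0].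
by split=> // [[|i]].
Qed.

(** The cone with [y = 'X_j] and [g = 'X_[w]]: the two hypotheses say that [w] carries [T] into [S]
    and that the colon of [S] by the new generator lies in [T]. The shift of the second resolution
    by one gives [e.+1]. *)
Lemma has_pd_cons S T w (j : 'I_n) d e :
  (forall v, v \in T -> exists2 s, s \in S & (s <= w + v)%MM) ->
  (forall m s, s \in S -> (s <= U_(j) + w + m)%MM -> exists2 v, v \in T & (v <= m)%MM) ->
  has_pd S d -> has_pd T e -> has_pd ((U_(j) + w)%MM :: S) (maxn d e.+1).
Proof.
move=> h1 h2 [F [Fd Fgt]] [G [Ge Ggt]].
have [||||||H HE] := @cone_idealRes k n (mono_ideal S) (mono_ideal T)
  (mono_ideal ((U_(j) + w)%MM :: S)) 'X_j 'X_[w] (mdeg U_(j)) (mdeg w) F G.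
- by rewrite /= dhomogX.
- by rewrite /= dhomogX.
- by apply/mem_ideal_gen/mapP; exists j; rewrite ?mem_enum.
- move=> p hp; apply/mono_ideal_mulX => m /hp[v /h1[s sS sv] vm].
  exists s => //; apply: lepm_trans sv _; apply/mnm_lepP => i.
  by rewrite !mnmDE leq_add2l; apply/mnm_lepP: i.
- by move=> p; rewrite -mpolyXD => /mono_ideal_mulX hp m /hp[s]; exact: h2.
- by move=> p; rewrite -mpolyXD; exact: mono_ideal_cons.
exists H; rewrite !HE; split=> [|i].
  rewrite /maxn; case: (ltnP d e.+1) => [_|]; first by rewrite /= addn_gt0 Ge orbT.
  by case: d Fd {Fgt} => // d Fd _; rewrite /= addn_gt0 Fd.
rewrite gtn_max HE => /andP[di]; case: i di => // i di ei.
by rewrite /= Fgt // Ggt.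
Qed.

End MonomialIdeals.

(** * Path ideals of the line graph and the recursion for their projective dimension *)

Section PathIdeals.
Variables (k : fieldType) (n t : nat).
Hypothesis t0 : (1 < t)%N.
Local Notation R := {mpoly k[n]}.

(* [x_a x_{a+1} .. x_{b-1}], with indices starting from 0 *)
Definition interval_mnm (a b : nat) : 'X_{1..n} := [multinom ((a <= i < b)%N : nat) | i < n].

(** The order is reversed so that adding the next generator is a cons. *)
Definition path_mnms (c : nat) : seq 'X_{1..n} :=
  [seq interval_mnm i (i + t) | i <- rev (iota 0 c)].

Lemma path_mnmsS c : path_mnms c.+1 = interval_mnm c (c + t) :: path_mnms c.
Proof. by rewrite /path_mnms -addn1 iotaD rev_cat. Qed.

Lemma path_mnmsP c (w : 'X_{1..n}) :
  reflect (exists2 i, (i < c)%N & w = interval_mnm i (i + t)) (w \in path_mnms c).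
Proof.
apply: (iffP mapP) => -[i ic ->]; exists i => //.
  by rewrite mem_rev mem_iota in ic.
by rewrite mem_rev mem_iota.
Qed.

Lemma interval_mnm_le_addr a b (w m : 'X_{1..n}) :
  (forall i : 'I_n, (a <= i < b)%N -> w i = 0%N) ->
  (interval_mnm a b <= w + m)%MM -> (interval_mnm a b <= m)%MM.
Proof.
move=> w0 /mnm_lepP h; apply/mnm_lepP => i; have := h i.
rewrite mnmE mnmDE; case i_ab: (_ <= _ < _)%N => //=.
by rewrite w0.
Qed.

(* The projective dimension for [c] generators, i.e. [c + t - 1] variables. *)
Definition path_pd (c : nat) : nat :=
  let m := (c + t).-1 in (2 * (m %/ t.+1) + (m %% t.+1 == t))%N.

(** As a function [f] of the number of variables, the value grows by 2 under a shift by [t.+1] and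
    is monotone, so the second entry always attains the maximum. At [c = 0] the recursion fails: a
    single generator gives 1. *)
Lemma path_pd_rec c : (0 < c)%N ->
  path_pd c.+1 = maxn (path_pd c) (path_pd (c - t)).+2.
Proof.
pose f m := (2 * (m %/ t.+1) + (m %% t.+1 == t))%N.
have f_shift m : f (m + t.+1)%N = (f m).+2.
  by rewrite /f divnDr // divnn /= modnDr; lia.
have f_mono m : (f m <= f m.+1)%N.
  rewrite /f; have := divn_eq m t.+1; have := ltn_pmod m (ltn0Sn t).
  move: (m %/ t.+1)%N (m %% t.+1)%N => q r rt ->.
  have [->|rne] := eqVneq r t.
    rewrite (_ : (q * t.+1 + t).+1 = q.+1 * t.+1)%N; last by rewrite mulSn; lia.
    by rewrite mulnK //; lia.
  by rewrite -addnS divnMDl // divn_small //; lia.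
move=> c0; have E : path_pd c.+1 = (path_pd (c - t)).+2.
  have [ct|ct] := leqP t c.
    by rewrite /path_pd -f_shift; congr f; lia.
  (* For [c < t] the difference is truncated, but [f] vanishes both at [c.-1] and at [t.-1]. *)
  rewrite (_ : c - t = 0)%N; last by lia.
  rewrite /path_pd -!/(f _) (_ : (c.+1 + t).-1 = c.-1 + t.+1)%N; last by lia.
  by rewrite f_shift /f !divn_small ?modn_small; lia.
have : (path_pd c <= path_pd c.+1)%N.
  by have := f_mono (c + t).-1; rewrite prednK //; lia.
by rewrite E => /maxn_idPr.
Qed.

Lemma interval_mnm_recr a b (j : 'I_n) : (a <= j)%N -> b = j.+1 ->
  interval_mnm a b = (U_(j) + interval_mnm a j)%MM.
Proof.
move=> aj ->; apply/mnmP => i; rewrite mnmDE mnm1E !mnmE -val_eqE /=.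
lia.
Qed.

Lemma path_mnms_has_pd c : (c + t <= n.+1)%N -> has_pd k (path_mnms c) (path_pd c).
Proof.
have [N] := ubnP c; elim: N c => // N IH [_ _|c].
  rewrite (_ : path_pd 0 = 0%N); first exact: has_pd0.
  by rewrite /path_pd add0n divn_small ?modn_small; lia.
rewrite ltnS => cN ctn.
have ltj : (c + t.-1 < n)%N by lia.
have intE : interval_mnm c (c + t) = (U_(Ordinal ltj) + interval_mnm c (c + t.-1))%MM.
  by apply: interval_mnm_recr => /=; lia.
rewrite path_mnmsS intE; case: c => [|c] in cN ctn ltj intE *.
  (* The first generator is added to the zero ideal, whose colon is again zero. *)
  rewrite (_ : path_pd 1 = maxn 0 1).
    by apply: (@has_pd_cons _ _ _ [::]) => //; exact: has_pd0.
  rewrite /path_pd add1n /= divn_small ?modn_small ?eqxx; lia.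
rewrite path_pd_rec //; have ltc : (c < n)%N by lia.
pose x := Ordinal ltc.
(* I_c : w_c = (x_(c-1)) + I_(c-t), with [c.+1] for c here *)
apply: (@has_pd_cons _ _ _ ((U_(x) + 0)%MM :: path_mnms (c.+1 - t))).
- move=> v; rewrite inE => /predU1P[->|/path_mnmsP[i ic ->]].
    (* The variable [x] times the new generator without its last variable is exactly the preceding
       generator. *)
    exists (interval_mnm c (c + t)); first by apply/path_mnmsP; exists c.
    apply/mnm_lepP => i; rewrite !(mnmDE, mnmE, mnm1E) -val_eqE /=; lia.
  exists (interval_mnm i (i + t)); last by rewrite addmC lem_addr.
  by apply/path_mnmsP; exists i => //; lia.
- move=> m _ /path_mnmsP[i ic ->]; rewrite -intE.
  (* Either the old generator is disjoint from the new one and must divide [m], or it contains [x],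
     which the new one lacks, so [x] divides [m]. *)
  have [it|it] := leqP (i + t) c.
    move=> h; exists (interval_mnm i (i + t)).
      by rewrite inE orbC; apply/orP; left; apply/path_mnmsP; exists i => //; lia.
    by apply: interval_mnm_le_addr h => l il; rewrite mnmE; lia.
  move=> /mnm_lepP/(_ x) h; exists (U_(x) + 0)%MM; first exact: mem_head.
  apply/mnm_lepP => l; rewrite addm0 mnm1E; case: eqP => // <-.
  by move: h; rewrite mnmDE !mnmE /=; lia.
- by apply: IH; lia.
(* Adjoining [x], coprime to the remaining generators, is a cone with both ideals equal and [w = 0];
   it raises the length by one. *)
rewrite -[path_pd (c.+1 - t)]maxnn -maxnSS.
rewrite (_ : maxn _ _ = maxn (path_pd (c.+1 - t)) (path_pd (c.+1 - t)).+1); last by lia.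
apply: (@has_pd_cons _ _ _ (path_mnms (c.+1 - t))).
- by move=> v vS; exists v; rewrite // add0m lepm_refl.
- move=> m _ /path_mnmsP[i ic ->] h; exists (interval_mnm i (i + t)).
    by apply/path_mnmsP; exists i.
  apply: interval_mnm_le_addr h => l il; rewrite addm0 mnm1E -val_eqE /=; lia.
- by apply: IH; lia.
by apply: IH; lia.
Qed.
Lemma path_succ x (s : seq nat) :
  path (fun a b => b == a.+1) x s = (s == iota x.+1 (size s)).
Proof. by elim: s x => //= y s IH x; rewrite IH eqseq_cons; case: eqP => // ->. Qed.

Lemma prod_consecutive_vars (s : seq 'I_n) a b :
  map val s = iota a b -> \prod_(i <- s) 'X_i = 'X_[interval_mnm a (a + b)] :> R.
Proof.
move=> sE; rewrite -(big_morph _ (@mpolyXD n k) (@mpolyX0 n k)); congr 'X_[_].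
have us : uniq s by rewrite -(map_inj_uniq val_inj) sE iota_uniq.
apply/mnmP => i; rewrite mnm_sumE mnmE -mem_iota -sE (mem_map val_inj).
rewrite -count_uniq_mem // -sum1_count [RHS]big_mkcond /=.
by apply: eq_bigr => j _; rewrite mnm1E; case: eqP.
Qed.

Lemma sorted_line_graph (s : seq 'I_n) :
  sorted (line_graph n) s = sorted (fun a b => b == a.+1) (map val s).
Proof. by rewrite sorted_map. Qed.

(** A path in the line graph is a run of consecutive vertices, and a run of [t] vertices fits
    exactly when it starts at an index at most [n - t]. *)
Lemma line_path_ideal p : (t <= n)%N ->
  mono_ideal (path_mnms (n - t).+1) p <-> p \in ideal_gen (path_gens k t (line_graph n)).
Proof.
move=> tn; apply: mono_ideal_gen => [w /path_mnmsP[a an ->]|q /mapP[s]].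
  have lt (l : 'I_t) : (a + l < n)%N by have := ltn_ord l; lia.
  pose s := [tuple Ordinal (lt l) | l < t].
  have sE : map val s = iota a t.
    rewrite -map_comp -(eq_map (_ : (fun l => (a + l)%N) \o val =1 _)) //.
    by rewrite map_comp val_enum_ord -iotaDl addn0.
  apply/mapP; exists s; last by rewrite (prod_consecutive_vars sE).
  rewrite mem_filter mem_enum andbT sorted_line_graph sE.
  case: (t) => //= u; rewrite path_succ size_iota eqxx //.
rewrite mem_filter sorted_line_graph => /andP[sorted_s _] ->.
case: s sorted_s => s /= /eqP s_t; case: s s_t => [|x s] /= s_t; first by lia.
rewrite path_succ size_map => /eqP sE.
have {}sE : map val (x :: s) = iota (val x) t by rewrite /= sE -s_t.
rewrite (prod_consecutive_vars sE) -['X_[_]]scale1r.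
apply: (@mono_idealX _ _ _ (interval_mnm (val x) (val x + t))); last exact: lepm_refl.
apply/path_mnmsP; exists (val x) => //.
have : (val x + t.-1)%N \in map val (x :: s) by rewrite sE mem_iota; lia.
by move=> /mapP[y _ yE]; have := ltn_ord y; rewrite /= in yE *; lia.
Qed.

Lemma line_path_quot_projdim : (t <= n)%N ->
  projdim (path_quot k t (line_graph n)) (path_pd (n - t).+1).
Proof.
move=> tn; have [|F [F0 Fgt]] := @path_mnms_has_pd (n - t).+1; first by lia.
have [H mH HE] := quot_minimal_res (path_gens_homog k t (line_graph n)) F
  (fun p => line_path_ideal p tn).
apply: (projdim_minimal_res mH); split=> [|i pi]; rewrite HE //.
exact: Fgt.
Qed.

End PathIdeals.

(** * The closed formula by division of n by t + 1 *)

Theorem theorem1p2 (n t : nat) (k : fieldType) :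
  (2 <= t)%N -> (t <= n)%N ->
  (forall d : nat, (d <= t - 1)%N -> n = d %[mod t + 1] ->
     projdim (path_quot k t (line_graph n)) ((2 * (n - d)) %/ (t + 1))%N) /\
  (n = t %[mod t + 1] ->
     projdim (path_quot k t (line_graph n)) ((2 * n - (t - 1)) %/ (t + 1))%N).
Proof.
move=> t2 tn; have := line_path_quot_projdim k t2 tn.
rewrite /path_pd (_ : ((n - t).+1 + t).-1 = n); last by lia.
have := divn_eq n t.+1; rewrite addn1.
move: (n %/ t.+1)%N (n %% t.+1)%N (ltn_pmod n (ltn0Sn t)) => q r rt nE pd.
rewrite (modn_small (ltnSn t)); split=> [d dt|] nd.
  rewrite modn_small in nd; last by lia.
  rewrite nd (_ : d == t = false) in nE pd; last by lia.
  (* The remainder is [d], so the division is exact with quotient [2 * q]. *)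
  rewrite (_ : 2 * (n - d) = 2 * q * t.+1)%N ?mulnK //; last by rewrite nE addnK mulnA.
  by rewrite addn0 in pd.
rewrite nd eqxx in nE pd.
(* With remainder [t], the leftover [2 * t - (t - 1)] is one more copy of [t.+1]. *)
rewrite (_ : 2 * n - (t - 1) = (2 * q + 1) * t.+1)%N ?mulnK //.
rewrite nE mulnDl -mulnA mul1n mulnDr; lia.
Qed.
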